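(* Let $T_t=\sum_{i=0}^{+\infty}T_it^i$ be a formal deformation of an $\mathcal{O}$-operator $T$ on a L.t.sRep pair $(L,[\cdot,\cdot,\cdot];\theta)$, with $\theta$ a representation on $V$. Then $T_1$ is a $1$-cocycle in the cohomology of the $\mathcal{O}$-operator $T$, that is, $d_T(T_1)=0$.
   Context: All vector spaces are over a field $\mathbb{K}$ of characteristic $0$. A Lie triple system (L.t.s) is a vector space $L$ with a trilinear bracket $[\cdot,\cdot,\cdot]:\wedge^2L\otimes L\to L$ (skew-symmetric in the first two arguments) such that for all $x,y,z,t,e\in L$: $[x,y,z]+[y,z,x]+[z,x,y]=0$ and $[x,y,[z,t,e]]=[[x,y,z],t,e]+[z,[x,y,t],e]+[z,t,[x,y,e]]$. A representation of $L$ on a vector space $V$ is a bilinear map $\theta:\otimes^2L\to End(V)$ such that, with $D(x,y)=\theta(y,x)-\theta(x,y)$, for all $x,y,z,t\in L$: $\theta(z,t)\theta(x,y)-\theta(y,t)\theta(x,z)-\theta(x,[y,z,t])+D(y,z)\theta(x,t)=0$ and $\theta(z,t)D(x,y)-D(x,y)\theta(z,t)+\theta([x,y,z],t)+\theta(z,[x,y,t])=0$. A L.t.s together with a representation is called a L.t.sRep pair $(L,[\cdot,\cdot,\cdot];\theta)$. A linear map $T:V\to L$ is an $\mathcal{O}$-operator on the pair if $[Tu,Tv,Tw]=T\big(D(Tu,Tv)w+\theta(Tv,Tw)u-\theta(Tu,Tw)v\big)$ for all $u,v,w\in V$. Then $V$ is a L.t.s under $[u,v,w]_T=D(Tu,Tv)w+\theta(Tv,Tw)u-\theta(Tu,Tw)v$,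 and $\theta_T(u,v)x=[x,Tu,Tv]+T\big(\theta(x,Tv)u-D(x,Tu)v\big)$ is a representation of it on $L$; put $D_T(u,v)=\theta_T(v,u)-\theta_T(u,v)$. For a linear map $f:V\to L$, $(d_Tf)(v_1,v_2,v_3)=D_T(v_1,v_2)f(v_3)-\theta_T(v_1,v_3)f(v_2)+\theta_T(v_2,v_3)f(v_1)-f([v_1,v_2,v_3]_T)$; $f$ is a $1$-cocycle if $d_Tf=0$. The bracket of $L$ and the maps $\theta$, $D$ are extended $\mathbb{K}[[t]]$-multilinearly (coefficientwise, by Cauchy product) to formal power series $L[[t]]$, $V[[t]]$. A formal deformation of $T$ is a power series $T_t=\sum_{i\ge0}T_it^i$ with $T_i\in Hom_{\mathbb{K}}(V,L)$, $T_0=T$, satisfying $[T_t(u),T_t(v),T_t(w)]=T_t\big(D(T_t(u),T_t(v))w+\theta(T_t(v),T_t(w))u-\theta(T_t(u),T_t(w))v\big)$ for all $u,v,w\in V$ ($T_t$ being extended to a $\mathbb{K}[[t]]$-module map $V[[t]]\to L[[t]]$). *)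

(* Defs.v *)
From mathcomp Require Import all_boot all_order all_algebra.

Set Implicit Arguments.
Unset Strict Implicit.
Unset Printing Implicit Defensive.

Import GRing.Theory.
Local Open Scope ring_scope.

(* Vector spaces are arbitrary K-modules [lmodType K], so they need not be
   finite-dimensional, and [{linear V -> V}] plays the role of End(V). *)

Definition trilinear (K : fieldType) (A B C E : lmodType K)
    (F : A -> B -> C -> E) : Prop :=
  [/\ forall b c, linear (fun a => F a b c),
      forall a c, linear (fun b => F a b c) &
      forall a b, linear (F a b)].

Record is_lts (K : fieldType) (L : lmodType K) (br : L -> L -> L -> L) : Prop :=
  IsLts {
    lts_trilinear : trilinear br;
    lts_skew : forall x y z, br x y z = - br y x z;
    lts_cyclic : forall x y z, br x y z + br y z x + br z x y = 0;
    lts_derivation : forall x y z t e,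
      br x y (br z t e) =
      br (br x y z) t e + br z (br x y t) e + br z t (br x y e)
  }.

Definition repD (K : fieldType) (L V : lmodType K)
    (theta : L -> L -> {linear V -> V}) (x y : L) (v : V) : V :=
  theta y x v - theta x y v.

(* The identities in End(V) are stated pointwise, products in End(V) being
   compositions; linearity in the last argument is carried by the type. *)
Record is_lts_rep (K : fieldType) (L V : lmodType K) (br : L -> L -> L -> L)
    (theta : L -> L -> {linear V -> V}) : Prop :=
  IsLtsRep {
    rep_linearl : forall y v, linear (fun x => theta x y v);
    rep_linearr : forall x v, linear (fun y => theta x y v);
    rep_theta : forall x y z t v,
      theta z t (theta x y v) - theta y t (theta x z v)
      - theta x (br y z t) v + repD theta y z (theta x t v) = 0;
    rep_D : forall x y z t v,
      theta z t (repD theta x y v) - repD theta x y (theta z t v)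
      + theta (br x y z) t v + theta z (br x y t) v = 0
  }.

Record is_ltsRep_pair (K : fieldType) (L V : lmodType K)
    (br : L -> L -> L -> L) (theta : L -> L -> {linear V -> V}) : Prop :=
  IsLtsRepPair {
    pair_lts : is_lts br;
    pair_rep : is_lts_rep br theta
  }.

Definition brT (K : fieldType) (L V : lmodType K)
    (theta : L -> L -> {linear V -> V}) (T : {linear V -> L}) (u v w : V) : V :=
  repD theta (T u) (T v) w + theta (T v) (T w) u - theta (T u) (T w) v.

Definition is_O_operator (K : fieldType) (L V : lmodType K)
    (br : L -> L -> L -> L) (theta : L -> L -> {linear V -> V})
    (T : {linear V -> L}) : Prop :=
  forall u v w, br (T u) (T v) (T w) = T (brT theta T u v w).

Definition thetaT (K : fieldType) (L V : lmodType K)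
    (br : L -> L -> L -> L) (theta : L -> L -> {linear V -> V})
    (T : {linear V -> L}) (u v : V) (x : L) : L :=
  br x (T u) (T v) + T (theta x (T v) u - repD theta x (T u) v).

Definition DT (K : fieldType) (L V : lmodType K)
    (br : L -> L -> L -> L) (theta : L -> L -> {linear V -> V})
    (T : {linear V -> L}) (u v : V) (x : L) : L :=
  thetaT br theta T v u x - thetaT br theta T u v x.

Definition dT (K : fieldType) (L V : lmodType K)
    (br : L -> L -> L -> L) (theta : L -> L -> {linear V -> V})
    (T f : {linear V -> L}) (v1 v2 v3 : V) : L :=
  DT br theta T v1 v2 (f v3) - thetaT br theta T v1 v3 (f v2)
  + thetaT br theta T v2 v3 (f v1) - f (brT theta T v1 v2 v3).

Definition is_1cocycle (K : fieldType) (L V : lmodType K)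
    (br : L -> L -> L -> L) (theta : L -> L -> {linear V -> V})
    (T f : {linear V -> L}) : Prop :=
  forall v1 v2 v3, dT br theta T f v1 v2 v3 = 0.

(* U[[t]], a series being its sequence of coefficients; equality of series is
   [=1] and their sum and difference are [\+] and [\-]. *)
Definition fps (U : Type) : Type := nat -> U.

Definition fps_const (U : zmodType) (u : U) : fps U :=
  fun n => if n == 0%N then u else 0.

(* The K[[t]]-multilinear extension to series of a trilinear map. *)
Definition fps_tri (A B C : Type) (E : zmodType) (F : A -> B -> C -> E)
    (a : fps A) (b : fps B) (c : fps C) : fps E :=
  fun n => \sum_(i < n.+1) \sum_(j < n.+1) \sum_(k < n.+1 | (i + j + k == n)%N)
             F (a i) (b j) (c k).

(* The extension of \sum_i T_i t^i to a K[[t]]-linear map V[[t]] -> L[[t]]. *)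
Definition fps_app (K : fieldType) (V L : lmodType K)
    (Tt : fps {linear V -> L}) (v : fps V) : fps L :=
  fun n => \sum_(i < n.+1) \sum_(j < n.+1 | (i + j == n)%N) Tt i (v j).

Record is_formal_deformation (K : fieldType) (L V : lmodType K)
    (br : L -> L -> L -> L) (theta : L -> L -> {linear V -> V})
    (T : {linear V -> L}) (Tt : fps {linear V -> L}) : Prop :=
  IsFormalDeformation {
    deformation_0 : Tt 0%N =1 T;
    deformation_O_operator : forall u v w : V,
      let Tc x := fps_app Tt (fps_const x) in
      let theta_t := fps_tri (fun x y z => theta x y z) in
      let D_t := fps_tri (repD theta) in
      fps_tri br (Tc u) (Tc v) (Tc w) =1
      fps_app Tt (D_t (Tc u) (Tc v) (fps_const w)
                  \+ theta_t (Tc v) (Tc w) (fps_const u)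
                  \- theta_t (Tc u) (Tc w) (fps_const v))
  }.

(* Main.v *)
Require Import Defs.
From mathcomp Require Import all_boot all_order all_algebra.

Import GRing.Theory.
Local Open Scope ring_scope.

(** The equation that defines a formal deformation is an equality of power
    series; its coefficient of degree 1 is the linearization at T of the
    O-operator equation, taken in the direction f = T_1:

      [fu,Tv,Tw] + [Tu,fv,Tw] + [Tu,Tv,fw]
        = f [u,v,w]_T + T (derivative at T of [u,v,w]_T in the direction f),

    see [deformation_linearized]. On the other side, unfolding theta_T and D_T
    shows that, for every linear f, the cochain d_T f is the difference of the
    two sides ([dT_linearized]): the coboundary of a 1-cochain measures how far
    it is from being an infinitesimal deformation. This uses the
    skew-symmetry of the bracket, and its cyclic identity through the formula
    for D_T in [DT_bracket]. *)

Section PowerSeries.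

Lemma fps_app_const (K : fieldType) (V L : lmodType K)
    (Tt : fps {linear V -> L}) (v : V) n :
  fps_app Tt (fps_const v) n = Tt n v.
Proof.
rewrite /fps_app big_ord_recr /= big1 => [|i _].
  rewrite add0r (big_pred1 ord0) //= => j.
  by rewrite -[X in _ == X]addn0 eqn_add2l.
rewrite big1 // => j /eqP ijn; rewrite /fps_const ifN ?linear0 //.
apply: contraTneq (ltn_ord i) => j0.
by rewrite -[X in (_ < X)%N]ijn j0 addn0 ltnn.
Qed.

Lemma fps_app_coef1 (K : fieldType) (V L : lmodType K)
    (Tt : fps {linear V -> L}) (v : fps V) :
  fps_app Tt v 1 = Tt 0%N (v 1%N) + Tt 1%N (v 0%N).
Proof.
by rewrite /fps_app; do !rewrite 1?big_mkcond !big_ord_recl !big_ord0 /=;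
   rewrite !(add0r, addr0).
Qed.

Context {A B C : Type} {E : zmodType} (F : A -> B -> C -> E).

Lemma fps_tri_coef0 (a : fps A) (b : fps B) (c : fps C) :
  fps_tri F a b c 0 = F (a 0%N) (b 0%N) (c 0%N).
Proof. by rewrite /fps_tri !big_ord1 big_mkcond big_ord1. Qed.

Lemma fps_tri_coef1 (a : fps A) (b : fps B) (c : fps C) :
  fps_tri F a b c 1 = F (a 1%N) (b 0%N) (c 0%N) + F (a 0%N) (b 1%N) (c 0%N)
                      + F (a 0%N) (b 0%N) (c 1%N).
Proof.
rewrite /fps_tri !big_ord_recl !big_ord0 /=.
do 4!rewrite (big_mkcond (fun k : 'I_2 => _)) !big_ord_recl !big_ord0 /=.
rewrite !(add0r, addr0) /=.
by rewrite addrC [X in _ + X]addrC addrA.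
Qed.

End PowerSeries.

Section Linearization.

Context {K : fieldType} {L V : lmodType K} (br : L -> L -> L -> L)
  (theta : L -> L -> {linear V -> V}) (T : {linear V -> L}).

(** The derivative at T, in the direction f, of the bracket [u,v,w]_T, which is
    quadratic in T. *)
Definition brT_derivative (f : V -> L) (u v w : V) : V :=
  (repD theta (f u) (T v) w + repD theta (T u) (f v) w)
  + (theta (f v) (T w) u + theta (T v) (f w) u)
  - (theta (f u) (T w) v + theta (T u) (f w) v).

Definition br_derivative (f : V -> L) (u v w : V) : L :=
  br (f u) (T v) (T w) + br (T u) (f v) (T w) + br (T u) (T v) (f w).

Lemma repDC x y v : repD theta x y v = - repD theta y x v.
Proof. by rewrite /repD opprB. Qed.

(** The two brackets [x,Tv,Tu] - [x,Tu,Tv] of the definition of D_T collapse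
    to [Tu,Tv,x] by skew-symmetry and the cyclic identity. *)
Lemma DT_bracket (br_lts : is_lts br) u v x :
  DT br theta T u v x
  = br (T u) (T v) x + T (theta (T u) x v - theta (T v) x u).
Proof.
rewrite /DT /thetaT [- (br _ _ _ + _)]opprD addrACA -raddfB; congr (_ + T _).
  rewrite -(lts_skew br_lts) (lts_skew br_lts (T u) (T v)).
  by apply/eqP; rewrite -addr_eq0 addrAC (lts_cyclic br_lts).
rewrite /repD !opprB.
rewrite [LHS](AC ((1*2)*(2*1)) ((1*5)*(2*6)*(4*3)))/=.
by rewrite !subrr !add0r.
Qed.

(** Skew-symmetry matches the brackets, -[fv,Tu,Tw] = [Tu,fv,Tw], and
    -D(fv,Tu) = D(Tu,fv) matches the terms in D. *)
Lemma dT_linearized (br_lts : is_lts br) (f : {linear V -> L}) u v w :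
  dT br theta T f u v w
  = br_derivative f u v w
    - (T (brT_derivative f u v w) + f (brT theta T u v w)).
Proof.
rewrite opprD addrA /dT; congr (_ - _).
rewrite (DT_bracket br_lts) /thetaT [- (br _ _ _ + _)]opprD.
rewrite [LHS](AC (2*2*2) ((1*3*5)*(2*4*6)))/=.
rewrite -!raddfB -raddfD -[- T _]raddfN; congr (_ + T _).
  by rewrite -(lts_skew br_lts) [LHS](AC 3 (3*2*1)).
rewrite /brT_derivative (repDC (T u) (f v)).
(* The values of D are generalized to keep them from being unfolded, as
   differences, by the rewriting below. *)
move: (repD _ (f v) _ _) (repD _ (f u) _ _) => x y.
by rewrite !(opprB, opprD, opprK) [LHS](AC (2*2*2) ((5*1)*((3*6)*(4*2)))).
Qed.

(** Holds because the coefficient of degree 1 of a series T_t u is T_1 u and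
    the constant series w contributes only in degree 0. *)
Lemma deformation_linearized (Tt : fps {linear V -> L}) (u v w : V) :
  is_formal_deformation br theta T Tt ->
  br_derivative (Tt 1%N) u v w
  = T (brT_derivative (Tt 1%N) u v w) + Tt 1%N (brT theta T u v w).
Proof.
case=> Tt0 /(_ u v w 1%N) /=.
rewrite fps_app_coef1 /= !fps_tri_coef1 !fps_tri_coef0 !fps_app_const !Tt0.
by rewrite /fps_const /= /repD !linear0 !addr0.
Qed.

End Linearization.

Theorem proposition5p3 (K : fieldType) (charK0 : [pchar K] =i pred0)
    (L V : lmodType K) (br : L -> L -> L -> L)
    (theta : L -> L -> {linear V -> V})
    (pair_Ltheta : is_ltsRep_pair br theta)
    (T : {linear V -> L}) (T_O : is_O_operator br theta T)
    (Tt : fps {linear V -> L})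
    (Tt_def : is_formal_deformation br theta T Tt) :
  is_1cocycle br theta T (Tt 1%N).
Proof.
move=> u v w; rewrite (dT_linearized _ _ _ (pair_lts pair_Ltheta)).
by rewrite (deformation_linearized _ _ _ _ _ _ _ Tt_def) subrr.
Qed.
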